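(* For an orean form $F$ over a pointed category $\mathbb{C}$, the following conditions are equivalent: (i) $\mathbb{C}$ is a Puppe–Mitchell exact category (or equivalently, a Grandis exact category) and $F$ is (up to isomorphism of forms) its form of normal subobjects. (ii) $F$ is a binormal noetherian form. (iii) $F$ is a normal noetherian form admitting an exact meet decomposition. (iv) $F$ is a noetherian form admitting a right exact meet decomposition. (v) $F$ is an orean form satisfying (N2) and admitting a right exact meet decomposition. (vi) $F$ is a normal form satisfying (N2) and admitting an exact meet decomposition. (vii) $F$ is a binormal form satisfying (N2).
   Context: Exact categories. A Grandis exact category is a category equipped with an ideal $\mathcal{N}$ of null morphisms (a class of morphisms closed under composition on either side with arbitrary morphisms) such that all kernels and cokernels relative to $\mathcal{N}$ exist and every morphism factors as a cokernel followed by a kernel (relative to $\mathcal{N}$). A Puppe–Mitchell exact category is a pointed category (category with a zero object) having this property for $\mathcal{N}$ the class of zero morphisms. The form of normal subobjects has as clusters in $X$ the equivalence classes $[s]$ (under mutual factorization) of normal monomorphisms (kernels) $s$ with codomain $X$, with $[t]\geq_f[s]$ iff $fs=tu$ for some $u$. Forms. A form over a category $\mathbb{C}$ is a faithful functor $F\colon\mathbb{B}\to\mathbb{C}$ that is amnestic (an isomorphism of $\mathbb{B}$ sent to an identity morphism is an identity morphism). Objects of $\mathbb{B}$ sent to $X$ are called ($F$-)clusters in $X$. For $f\colon X\to Y$, a cluster $A$ in $X$ and a cluster $B$ in $Y$, $B\geq_f A$ means that some morphism $A\to B$ of $\mathbb{B}$ is sent to $f$; $\geq$ denotes $\geq_{1_X}$,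 a partial order on the clusters in $X$. $F$ is orean if: (O1) for each $X$ the clusters in $X$ form a bounded lattice ($\bot_X,\top_X,\vee,\wedge$); (O2) for $f\colon X\to Y$, $g\colon Y\to Z$, if $C\geq_{gf}A$ then there is a cluster $B$ in $Y$ with $C\geq_g B$ and $B\geq_f A$; (O3) for $f\colon X\to Y$ and a cluster $S$ in $X$ there is a least cluster $f\cdot S$ in $Y$ among those $T$ with $T\geq_f S$, and for a cluster $T$ in $Y$ there is a largest cluster $T\cdot f$ in $X$ among those $S$ with $T\geq_f S$. For $f\colon X\to Y$ put $\mathrm{Im} f=f\cdot\top_X$, $\mathrm{Ker} f=\bot_Y\cdot f$. A cluster is conormal (normal) if it is the image (kernel) of some morphism. An orean form is conormal (normal) if all its clusters are, and binormal if it is both. Operators. An operator $\tau\colon F\to G$ between forms over $\mathbb{C}$ is a functor between the domains with $G\circ\tau=F$; equivalently, a map of clusters over each object such that $B\geq_f A$ implies $\tau B\geq_f\tau A$. Isomorphisms of forms are invertible operators. A collection of $F$-clusters, with the relations $\geq_f$ restricted, is a subform of $F$. For an idempotent operator $\tau\colon F\to F$, $F_\tau$ is the subform of clusters $S$ with $\tau S=S$. An operator of orean forms is conormal if $\tau(\mathrm{Im}^F f)=\mathrm{Im}^G f$ for all $f$, normal if $\tau(\mathrm{Ker}^F f)=\mathrm{Ker}^G f$ for all $f$, binormal if both. Noetherian forms. For an orean form, an embedding of a conormal cluster $S$ in $X$ is a morphism $m\colon W\to X$ with $\mathrm{Im}\, m=S$ such that every $m'\colon W'\to X$ with $\mathrm{Im}\,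 m'\leq S$ factors uniquely as $m'=mg$. A quotient of a normal cluster $S$ in $X$ is a morphism $q\colon X\to Y$ with $\mathrm{Ker}\, q=S$ such that every $q'\colon X\to Y'$ with $\mathrm{Ker}\, q'\geq S$ factors uniquely as $q'=hq$. An orean form is noetherian if: (N1) for every $f\colon X\to Y$, $(f\cdot S)\cdot f=S\vee\mathrm{Ker} f$ for all clusters $S$ in $X$, and $f\cdot(T\cdot f)=T\wedge\mathrm{Im} f$ for all clusters $T$ in $Y$; (N2) every morphism $f$ factors as $f=me$ with $m$ an embedding of $\mathrm{Im} f$ and $e$ a quotient of $\mathrm{Ker} f$; (N3) the join of two normal clusters is normal and the meet of two conormal clusters is conormal. Exact meet decomposition. A meet decomposition of an orean form $F$ is a pair $(\kappa_s,\kappa_e)$ of idempotent operators $F\to F$ such that $F_s=F_{\kappa_s}$ is a conormal orean form, $F_e=F_{\kappa_e}$ is a normal orean form, and $S=\kappa_s S\wedge\kappa_e S$ for every cluster $S$. It is a right decomposition if moreover $S=\kappa_e S$ for every cluster $S$. It is exact if the restrictions $\tau_s\colon F\to F_s$, $\tau_e\colon F\to F_e$ of $\kappa_s,\kappa_e$ are binormal, there exist a conormal operator $F_s\to F_e$ and a normal operator $F_e\to F_s$, the subform inclusion $F_s\to F$ is conormal and the subform inclusion $F_e\to F$ is normal. *)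

(* Defs.v *)
From mathcomp Require Import ssreflect ssrfun ssrbool seq.
From mathcomp Require Import boolp.

Set Implicit Arguments.
Unset Strict Implicit.
Unset Printing Implicit Defensive.

Declare Scope form_theory_scope.
Delimit Scope form_theory_scope with FT.
Local Open Scope form_theory_scope.

(** * Categories, functors, identities *)

Record category := Category {
  ob :> Type;
  hom : ob -> ob -> Type;
  idm : forall X, hom X X;
  comp : forall X Y Z, hom Y Z -> hom X Y -> hom X Z;
  comp1m : forall X Y (f : hom X Y), comp (idm Y) f = f;
  compm1 : forall X Y (f : hom X Y), comp f (idm X) = f;
  compA : forall X Y Z W (h : hom Z W) (g : hom Y Z) (f : hom X Y),
    comp h (comp g f) = comp (comp h g) f }.

Arguments hom {c} X Y.
Arguments idm {c} X.
Arguments comp {c X Y Z} g f.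

Notation "g ∘ f" := (comp g f) (at level 40, left associativity)
  : form_theory_scope.

Record functor (B C : category) := Functor {
  fob :> B -> C;
  fhom : forall A A' : B, hom A A' -> hom (fob A) (fob A');
  fhom_id : forall A, fhom (idm A) = idm (fob A);
  fhom_comp : forall A A' A'' (h' : hom A' A'') (h : hom A A'),
    fhom (h' ∘ h) = fhom h' ∘ fhom h }.

Arguments fhom {B C} f {A A'} h.

Definition hom_cast (C : category) (X X' Y Y' : C) (eX : X = X') (eY : Y = Y') :
    hom X Y -> hom X' Y' :=
  match eX in _ = X1, eY in _ = Y1 return hom X Y -> hom X1 Y1 with
  | erefl, erefl => fun f => f
  end.

(* The domain and codomain of an identity are only propositionally equal here,
   as is needed for an image F h, with h : A -> B, F A = F B. *)
Definition is_identity (C : category) (X Y : C) (f : hom X Y) : Prop :=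
  exists e : X = Y, hom_cast e erefl f = idm Y.

Definition is_iso (C : category) (X Y : C) (f : hom X Y) : Prop :=
  exists g : hom Y X, g ∘ f = idm X /\ f ∘ g = idm Y.

(** * Null morphisms and exact categories *)

Record ideal (C : category) := Ideal {
  null :> forall X Y : C, hom X Y -> Prop;
  null_compl : forall (X Y Z : C) (g : hom Y Z) (f : hom X Y), null f -> null (g ∘ f);
  null_compr : forall (X Y Z : C) (g : hom Y Z) (f : hom X Y), null g -> null (g ∘ f) }.

Arguments null {C} i {X Y} f.

Definition is_zero_object (C : category) (Z : C) : Prop :=
  (forall X : C, exists! f : hom X Z, True) /\
  (forall X : C, exists! f : hom Z X, True).

Definition pointed (C : category) : Prop := exists Z : C, is_zero_object Z.

Definition is_zero_hom (C : category) (X Y : C) (f : hom X Y) : Prop :=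
  exists Z : C, is_zero_object Z /\
    exists (v : hom Z Y) (u : hom X Z), f = v ∘ u.

Lemma is_zero_hom_compl (C : category) (X Y Z : C) (g : hom Y Z) (f : hom X Y) :
  is_zero_hom f -> is_zero_hom (g ∘ f).
Proof.
by move=> [W [hW [v [u ->]]]]; exists W; split=> //; exists (g ∘ v), u; rewrite compA.
Qed.

Lemma is_zero_hom_compr (C : category) (X Y Z : C) (g : hom Y Z) (f : hom X Y) :
  is_zero_hom g -> is_zero_hom (g ∘ f).
Proof.
by move=> [W [hW [v [u ->]]]]; exists W; split=> //; exists v, (u ∘ f); rewrite compA.
Qed.

Definition zero_ideal (C : category) : ideal C :=
  @Ideal C (@is_zero_hom C) (@is_zero_hom_compl C) (@is_zero_hom_compr C).

Definition is_kernel (C : category) (N : ideal C) (X Y : C) (f : hom X Y)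
    (K : C) (k : hom K X) : Prop :=
  null N (f ∘ k) /\
  forall (W : C) (g : hom W X), null N (f ∘ g) -> exists! u : hom W K, g = k ∘ u.

Definition is_cokernel (C : category) (N : ideal C) (X Y : C) (f : hom X Y)
    (Q : C) (q : hom Y Q) : Prop :=
  null N (q ∘ f) /\
  forall (W : C) (g : hom Y W), null N (g ∘ f) -> exists! u : hom Q W, g = u ∘ q.

Definition normal_mono (C : category) (N : ideal C) (K X : C) (k : hom K X) : Prop :=
  exists (Y : C) (f : hom X Y), is_kernel N f k.

Definition normal_epi (C : category) (N : ideal C) (Y Q : C) (q : hom Y Q) : Prop :=
  exists (X : C) (f : hom X Y), is_cokernel N f q.

Definition exact (C : category) (N : ideal C) : Prop :=
  [/\ forall (X Y : C) (f : hom X Y), exists (K : C) (k : hom K X), is_kernel N f k,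
      forall (X Y : C) (f : hom X Y), exists (Q : C) (q : hom Y Q), is_cokernel N f q
    & forall (X Y : C) (f : hom X Y), exists (I : C) (m : hom I Y) (e : hom X I),
        [/\ f = m ∘ e, normal_epi N e & normal_mono N m] ].

Definition puppe_mitchell_exact (C : category) : Prop :=
  pointed C /\ exact (zero_ideal C).

Definition grandis_exact (C : category) : Prop := exists N : ideal C, exact N.

(** * Forms and their clusters *)

Record form (C : category) := Form {
  dom : category;
  form_fun : functor dom C;
  form_faithful : forall (A B : dom) (h h' : hom A B),
    fhom form_fun h = fhom form_fun h' -> h = h';
  form_amnestic : forall (A B : dom) (h : hom A B),
    is_iso h -> is_identity (fhom form_fun h) -> is_identity h }.

Arguments dom {C} f.
Arguments form_fun {C} f.

Definition cluster (C : category) (F : form C) (X : C) : Type :=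
  {A : dom F | form_fun F A = X}.

(* [geq f B A] is the relation B >=_f A. *)
Definition geq (C : category) (F : form C) (X Y : C) (f : hom X Y)
    (B : cluster F Y) (A : cluster F X) : Prop :=
  exists h : hom (sval A) (sval B), hom_cast (proj2_sig A) (proj2_sig B) (fhom (form_fun F) h) = f.

Notation "B ≥[ f ] A" := (geq f B A) (at level 70, no associativity)
  : form_theory_scope.
Notation "A ≤ B" := (geq (idm _) B A) (at level 70, no associativity)
  : form_theory_scope.

(* The structure of an orean form. All the data are determined by F, since ≤ is
   antisymmetric; that ≤ is a partial order holds in every form. *)
Record orean (C : category) (F : form C) := Orean {
  (* O1 *)
  bot : forall X : C, cluster F X;
  top : forall X : C, cluster F X;
  join : forall X : C, cluster F X -> cluster F X -> cluster F X;
  meet : forall X : C, cluster F X -> cluster F X -> cluster F X;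
  bot_le : forall (X : C) (S : cluster F X), bot X ≤ S;
  le_top : forall (X : C) (S : cluster F X), S ≤ top X;
  join_le : forall (X : C) (S T U : cluster F X), join S T ≤ U <-> S ≤ U /\ T ≤ U;
  le_meet : forall (X : C) (S T U : cluster F X), U ≤ meet S T <-> U ≤ S /\ U ≤ T;
  (* O2 *)
  geq_interp : forall (X Y Z : C) (f : hom X Y) (g : hom Y Z)
      (A : cluster F X) (D : cluster F Z),
    D ≥[g ∘ f] A -> exists B : cluster F Y, D ≥[g] B /\ B ≥[f] A;
  (* O3: [dimg f S] is f·S and [iimg f T] is T·f *)
  dimg : forall (X Y : C) (f : hom X Y), cluster F X -> cluster F Y;
  iimg : forall (X Y : C) (f : hom X Y), cluster F Y -> cluster F X;
  dimg_geq : forall (X Y : C) (f : hom X Y) (S : cluster F X), dimg f S ≥[f] S;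
  dimg_least : forall (X Y : C) (f : hom X Y) (S : cluster F X) (T : cluster F Y),
    T ≥[f] S -> dimg f S ≤ T;
  iimg_geq : forall (X Y : C) (f : hom X Y) (T : cluster F Y), T ≥[f] iimg f T;
  iimg_largest : forall (X Y : C) (f : hom X Y) (S : cluster F X) (T : cluster F Y),
    T ≥[f] S -> S ≤ iimg f T }.

Arguments bot {C F} o X.
Arguments top {C F} o X.
Arguments join {C F} o {X} S T.
Arguments meet {C F} o {X} S T.
Arguments dimg {C F} o {X Y} f S.
Arguments iimg {C F} o {X Y} f T.

Section OreanForms.
Variables (C : category) (F : form C) (O : orean F).

Definition Im (X Y : C) (f : hom X Y) : cluster F Y := dimg O f (top O X).
Definition Ker (X Y : C) (f : hom X Y) : cluster F X := iimg O f (bot O Y).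

Definition conormal_cluster (X : C) (S : cluster F X) : Prop :=
  exists (W : C) (f : hom W X), Im f = S.
Definition normal_cluster (X : C) (S : cluster F X) : Prop :=
  exists (Y : C) (f : hom X Y), Ker f = S.

Definition conormal_form : Prop := forall (X : C) (S : cluster F X), conormal_cluster S.
Definition normal_form : Prop := forall (X : C) (S : cluster F X), normal_cluster S.
Definition binormal_form : Prop := normal_form /\ conormal_form.

Definition is_embedding (X : C) (S : cluster F X) (W : C) (m : hom W X) : Prop :=
  Im m = S /\
  forall (W' : C) (m' : hom W' X), Im m' ≤ S -> exists! g : hom W' W, m' = m ∘ g.

Definition is_quotient (X : C) (S : cluster F X) (Y : C) (q : hom X Y) : Prop :=
  Ker q = S /\
  forall (Y' : C) (q' : hom X Y'), S ≤ Ker q' -> exists! h : hom Y Y', q' = h ∘ q.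

Definition N1 : Prop := forall (X Y : C) (f : hom X Y),
  (forall S : cluster F X, iimg O f (dimg O f S) = join O S (Ker f)) /\
  (forall T : cluster F Y, dimg O f (iimg O f T) = meet O T (Im f)).

Definition N2 : Prop := forall (X Y : C) (f : hom X Y),
  exists (I : C) (m : hom I Y) (e : hom X I),
    [/\ f = m ∘ e, is_embedding (Im f) m & is_quotient (Ker f) e].

Definition N3 : Prop := forall (X : C) (S T : cluster F X),
  (normal_cluster S -> normal_cluster T -> normal_cluster (join O S T)) /\
  (conormal_cluster S -> conormal_cluster T -> conormal_cluster (meet O S T)).

Definition noetherian : Prop := [/\ N1, N2 & N3].

End OreanForms.

(** * Operators and subforms *)

(* An operator is given by its action on clusters: F and G being faithful, a functor
   t : dom F -> dom G with G t = F amounts to such a map, and operators are equal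
   when their actions on clusters are. *)
Record operator (C : category) (F G : form C) := Operator {
  op_map :> forall X : C, cluster F X -> cluster G X;
  op_geq : forall (X Y : C) (f : hom X Y) (B : cluster F Y) (A : cluster F X),
    B ≥[f] A -> op_map B ≥[f] op_map A }.

Definition form_iso (C : category) (F G : form C) : Prop :=
  exists (t : operator F G) (s : operator G F),
    (forall (X : C) (S : cluster F X), s X (t X S) = S) /\
    (forall (X : C) (S : cluster G X), t X (s X S) = S).

Definition idempotent_op (C : category) (F : form C) (t : operator F F) : Prop :=
  forall (X : C) (S : cluster F X), t X (t X S) = t X S.

(* A collection P of clusters, with the relations B >=_f A restricted, is the full
   subcategory of dom F on the A such that P holds of A as a cluster in F A. *)
Definition full_subcat (B : category) (P : B -> Prop) : category :=
  @Category {A : B | P A} (fun A A' => hom (sval A) (sval A'))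
    (fun A => idm (sval A)) (fun _ _ _ h' h => h' ∘ h)
    (fun _ _ h => comp1m h) (fun _ _ h => compm1 h) (fun _ _ _ _ h g f => compA h g f).

Section Subform.
Variables (C : category) (F : form C) (P : forall X : C, cluster F X -> Prop).

Let Q (A : dom F) : Prop := P (exist _ A erefl : cluster F (form_fun F A)).

Definition subform_fun : functor (full_subcat Q) C :=
  @Functor (full_subcat Q) C (fun A => form_fun F (sval A))
    (fun _ _ h => fhom (form_fun F) h)
    (fun A => fhom_id (form_fun F) (sval A))
    (fun _ _ _ h' h => fhom_comp (form_fun F) h' h).

Lemma subform_faithful (A B : full_subcat Q) (h h' : hom A B) :
  fhom subform_fun h = fhom subform_fun h' -> h = h'.
Proof. exact: form_faithful. Qed.

Lemma subform_amnestic (A B : full_subcat Q) (h : hom A B) :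
  is_iso h -> is_identity (fhom subform_fun h) -> is_identity h.
Proof.
move: A B h => [A pA] [B pB] /= h isoh idh.
have {isoh idh} [e eh] : @is_identity (dom F) A B h.
  by apply: form_amnestic => //; case: isoh => k hk; exists k.
destruct e; simpl in *; subst h.
by rewrite (Prop_irrelevance pB pA); exists erefl.
Qed.

Definition subform : form C := Form subform_faithful subform_amnestic.

Definition subform_incl_map (X : C) (S : cluster subform X) : cluster F X :=
  exist _ (sval (sval S)) (proj2_sig S).

Lemma subform_incl_geq (X Y : C) (f : hom X Y) (B : cluster subform Y)
    (A : cluster subform X) :
  B ≥[f] A -> subform_incl_map B ≥[f] subform_incl_map A.
Proof. exact. Qed.

Definition subform_incl : operator subform F := Operator subform_incl_geq.

Lemma subform_subproof (X : C) (S : cluster F X) : P S -> Q (sval S).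
Proof. by case: S => A e; destruct e. Qed.

Definition to_subform (X : C) (S : cluster F X) (pS : P S) : cluster subform X :=
  exist (fun A : full_subcat Q => form_fun F (sval A) = X)
    (exist Q (sval S) (subform_subproof pS)) (proj2_sig S).

End Subform.

Definition fixed_form (C : category) (F : form C) (t : operator F F) : form C :=
  subform (fun (X : C) (S : cluster F X) => t X S = S).

Definition fixed_incl (C : category) (F : form C) (t : operator F F) :
  operator (fixed_form t) F := @subform_incl C F _.

Section FixedRestr.
Variables (C : category) (F : form C) (t : operator F F) (idt : idempotent_op t).

Definition fixed_restr_map (X : C) (S : cluster F X) : cluster (fixed_form t) X :=
  to_subform (P := fun X (S : cluster F X) => t X S = S) (idt S).

Lemma fixed_restr_geq (X Y : C) (f : hom X Y) (B : cluster F Y) (A : cluster F X) :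
  B ≥[f] A -> fixed_restr_map B ≥[f] fixed_restr_map A.
Proof. exact: (@op_geq _ _ _ t). Qed.

Definition fixed_restr : operator F (fixed_form t) := Operator fixed_restr_geq.

End FixedRestr.

Section NormalOperators.
Variables (C : category) (F G : form C) (OF : orean F) (OG : orean G).

Definition conormal_op (t : operator F G) : Prop :=
  forall (X Y : C) (f : hom X Y), t Y (Im OF f) = Im OG f.
Definition normal_op (t : operator F G) : Prop :=
  forall (X Y : C) (f : hom X Y), t X (Ker OF f) = Ker OG f.
Definition binormal_op (t : operator F G) : Prop := normal_op t /\ conormal_op t.

End NormalOperators.

(** * Meet decompositions *)

Record meet_decomposition (C : category) (F : form C) (O : orean F) := MeetDecomposition {
  kappa_s : operator F F;
  kappa_e : operator F F;
  kappa_s_idem : idempotent_op kappa_s;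
  kappa_e_idem : idempotent_op kappa_e;
  orean_s : orean (fixed_form kappa_s);
  orean_e : orean (fixed_form kappa_e);
  orean_s_conormal : conormal_form orean_s;
  orean_e_normal : normal_form orean_e;
  meet_kappa : forall (X : C) (S : cluster F X), S = meet O (kappa_s X S) (kappa_e X S) }.

Section Decompositions.
Variables (C : category) (F : form C) (O : orean F).

Definition right_decomposition (D : meet_decomposition O) : Prop :=
  forall (X : C) (S : cluster F X), S = kappa_e D X S.

(* [fixed_restr (kappa_s_idem D)] is the corestriction tau_s : F -> F_s of kappa_s. *)
Definition exact_decomposition (D : meet_decomposition O) : Prop :=
  [/\ binormal_op O (orean_s D) (fixed_restr (kappa_s_idem D)) /\
      binormal_op O (orean_e D) (fixed_restr (kappa_e_idem D)),
      exists a : operator (fixed_form (kappa_s D)) (fixed_form (kappa_e D)),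
        conormal_op (orean_s D) (orean_e D) a,
      exists b : operator (fixed_form (kappa_e D)) (fixed_form (kappa_s D)),
        normal_op (orean_e D) (orean_s D) b,
      conormal_op (orean_s D) O (fixed_incl (kappa_s D))
    & normal_op (orean_e D) O (fixed_incl (kappa_e D)) ].

Definition has_exact_meet_decomposition : Prop :=
  exists D : meet_decomposition O, exact_decomposition D.

Definition has_right_exact_meet_decomposition : Prop :=
  exists D : meet_decomposition O, right_decomposition D /\ exact_decomposition D.

End Decompositions.

(** * The form of normal subobjects *)

Section FormOfClusters.
Variables (C : category) (cl : C -> Type).
Variable rel : forall X Y : C, hom X Y -> cl Y -> cl X -> Prop.
Hypothesis rel_refl : forall X (S : cl X), rel (idm X) S S.
Hypothesis rel_trans : forall X Y Z (f : hom X Y) (g : hom Y Z) A B D,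
  rel g D B -> rel f B A -> rel (g ∘ f) D A.
Hypothesis rel_anti : forall X (S T : cl X), rel (idm X) S T -> rel (idm X) T S -> S = T.

Lemma sig_hom_eq X Y (S : cl X) (T : cl Y) (h h' : {f : hom X Y | rel f T S}) :
  sval h = sval h' -> h = h'.
Proof. by move: h h' => [f p] [f' p'] /= e; subst f'; congr exist; apply: Prop_irrelevance. Qed.

Definition clusters_cat : category :=
  @Category {X : C & cl X}
    (fun A B => {f : hom (projT1 A) (projT1 B) | rel f (projT2 B) (projT2 A)})
    (fun A => exist _ (idm (projT1 A)) (rel_refl (projT2 A)))
    (fun _ _ _ h' h => exist _ (sval h' ∘ sval h) (rel_trans (proj2_sig h') (proj2_sig h)))
    (fun _ _ h => sig_hom_eq (comp1m (sval h) : sval (exist _ _ _) = _))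
    (fun _ _ h => sig_hom_eq (compm1 (sval h) : sval (exist _ _ _) = _))
    (fun _ _ _ _ h g f => sig_hom_eq
      (compA (sval h) (sval g) (sval f) : sval (exist _ _ _) = sval (exist _ _ _))).

Definition clusters_fun : functor clusters_cat C :=
  @Functor clusters_cat C (fun A => projT1 A) (fun _ _ h => sval h)
    (fun _ => erefl) (fun _ _ _ _ _ => erefl).

Lemma clusters_faithful (A B : clusters_cat) (h h' : hom A B) :
  fhom clusters_fun h = fhom clusters_fun h' -> h = h'.
Proof. exact: sig_hom_eq. Qed.

Lemma clusters_amnestic (A B : clusters_cat) (h : hom A B) :
  is_iso h -> is_identity (fhom clusters_fun h) -> is_identity h.
Proof.
move: A B h => [X S] [Y T] [f fST] [[g gTS] [/(congr1 sval) /= gf _]] /= [e].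
destruct e => /= f1; subst f.
rewrite compm1 in gf; subst g.
simpl in *; have eST := rel_anti fST gTS; subst T.
by exists erefl; apply: sig_hom_eq.
Qed.

Definition form_of_clusters : form C := Form clusters_faithful clusters_amnestic.

End FormOfClusters.

Section NormalSubobjects.
Variables (C : category) (N : ideal C).

Definition factors (X W W' : C) (s : hom W X) (t : hom W' X) : Prop :=
  exists u : hom W W', s = t ∘ u.

Definition mutually_factor (X W W' : C) (s : hom W X) (t : hom W' X) : Prop :=
  factors s t /\ factors t s.

(* An equivalence class, as a predicate on the morphisms with codomain X. *)
Definition is_nsub_class (X : C) (P : forall W : C, hom W X -> Prop) : Prop :=
  exists (W : C) (s : hom W X), normal_mono N s /\
    forall (W' : C) (t : hom W' X), P W' t <-> normal_mono N t /\ mutually_factor s t.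

Definition nsub (X : C) : Type := {P : forall W : C, hom W X -> Prop | is_nsub_class P}.

Definition nsub_geq (X Y : C) (f : hom X Y) (T : nsub Y) (S : nsub X) : Prop :=
  exists (V W : C) (t : hom V Y) (s : hom W X),
    [/\ sval T V t, sval S W s & exists u : hom W V, f ∘ s = t ∘ u].

Lemma nsub_mem (X : C) (S : nsub X) (W W' : C) (s : hom W X) (s' : hom W' X) :
  sval S W s -> sval S W' s' -> factors s s'.
Proof.
case: S => P [V [t [_ hP]]] /=.
move=> /hP [_ [_ [u ->]]] /hP [_ [[v ->] _]].
by exists (v ∘ u); rewrite compA.
Qed.

Lemma nsub_geq_refl (X : C) (S : nsub X) : nsub_geq (idm X) S S.
Proof.
have [W [s [sN hS]]] := proj2_sig S.
have sS : sval S W s.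
  by apply/hS; do ?split=> //; exists (idm W); rewrite compm1.
exists W, W, s, s; split=> //; exists (idm W); by rewrite comp1m compm1.
Qed.

Lemma nsub_geq_trans (X Y Z : C) (f : hom X Y) (g : hom Y Z)
    (A : nsub X) (B : nsub Y) (D : nsub Z) :
  nsub_geq g D B -> nsub_geq f B A -> nsub_geq (g ∘ f) D A.
Proof.
move=> [V [W [d [b [Dd Bb [u gb]]]]]] [V' [W' [b' [a [Bb' Aa [v fa]]]]]].
exists V, W', d, a; split=> //.
have [w bw] := nsub_mem Bb' Bb.
by exists (u ∘ w ∘ v); rewrite -compA fa bw !compA gb.
Qed.

Lemma nsub_geq_anti (X : C) (S T : nsub X) :
  nsub_geq (idm X) S T -> nsub_geq (idm X) T S -> S = T.
Proof.
move=> [V [W [s [t [Ss Tt [u tu]]]]]] [V' [W' [t' [s' [Tt' Ss' [v s'v]]]]]].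
rewrite comp1m in tu; rewrite comp1m in s'v.
have [w tw] := nsub_mem Tt' Tt; have [w' sw] := nsub_mem Ss Ss'.
have st : mutually_factor s t.
  split; last by exists u.
  by exists (w ∘ v ∘ w'); rewrite sw s'v tw !compA.
have sub (A B : nsub X) V1 V2 (a : hom V1 X) (b : hom V2 X) :
    sval A V1 a -> sval B V2 b -> mutually_factor a b ->
    forall U (r : hom U X), sval A U r -> sval B U r.
  move=> Aa Bb [ab ba] U r Ar.
  have [x rx] := nsub_mem Ar Aa; have [y ay] := nsub_mem Aa Ar.
  case: ab => [z az]; case: ba => [z' bz'].
  have [W0 [s0 [_ hB]]] := proj2_sig B.
  have [W1 [s1 [_ hA]]] := proj2_sig A.
  have [bN [[p s0p] [q bq]]] := (hB _ _).1 Bb.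
  apply/hB; split; first by case: ((hA _ _).1 Ar).
  split.
  - by exists (y ∘ z' ∘ p); rewrite s0p bz' ay !compA.
  - by exists (q ∘ z ∘ x); rewrite rx az bq !compA.
have eST : sval S = sval T; last first.
  clear -eST; move: S T eST => [A a] [B b] /= e; subst B.
  by congr exist; apply: Prop_irrelevance.
apply: functional_extensionality_dep => U; apply: functional_extensionality_dep => r.
apply/propext; split; first exact: sub Ss Tt st U r.
by apply: sub Tt Ss _ U r; case: st.
Qed.

Definition normal_subobjects : form C :=
  form_of_clusters nsub_geq_refl nsub_geq_trans nsub_geq_anti.

End NormalSubobjects.

(* Main.v *)
(**
  In a pointed category every null ideal of an exact category is the ideal of
  zero morphisms. If F is binormal and satisfies (N2), then g f = 0 means
  Im f <= Ker g, so embeddings of Ker f are kernels of f, quotients of Im f are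
  cokernels of f, and S |-> {embeddings of S} identifies F with the form of
  normal subobjects; in this case all epis are quotients and all monos are
  embeddings, and (N1) follows by diagram chasing. Conversely, in an exact
  category the clusters, represented by normal monos, have kernels and images
  represented by those of the category. An exact meet decomposition of a normal
  form forces kappa_s S = S, hence conormality, because the zero morphisms make
  the least clusters conormal.
*)
From mathcomp Require Import ssreflect ssrfun ssrbool seq.
From mathcomp Require Import boolp.
Require Import Defs.

Set Implicit Arguments.
Unset Strict Implicit.
Unset Printing Implicit Defensive.

Local Open Scope form_theory_scope.

(** * Monos, epis, kernels and zero morphisms in a pointed category *)

Definition mono (C : category) (X Y : C) (m : hom X Y) : Prop :=
  forall (W : C) (u v : hom W X), m ∘ u = m ∘ v -> u = v.

Definition epi (C : category) (X Y : C) (e : hom X Y) : Prop :=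
  forall (W : C) (u v : hom Y W), u ∘ e = v ∘ e -> u = v.

Section Category.
Variable C : category.
Implicit Types X Y Z W : C.

Lemma mono_comp X Y Z (g : hom Y Z) (f : hom X Y) : mono g -> mono f -> mono (g ∘ f).
Proof. by move=> mg mf W u v; rewrite -!compA => /mg /mf. Qed.

Lemma epi_comp X Y Z (g : hom Y Z) (f : hom X Y) : epi g -> epi f -> epi (g ∘ f).
Proof. by move=> eg ef W u v; rewrite !compA => /ef /eg. Qed.

Lemma epi_id X : epi (idm X).
Proof. by move=> W u v; rewrite !compm1. Qed.

Lemma kernel_mono (N : ideal C) X Y K (f : hom X Y) (k : hom K X) :
  is_kernel N f k -> mono k.
Proof.
move=> [fk0 kU] W u v e.
have [|w [_ wU]] := kU W (k ∘ u); first by rewrite compA; apply: null_compr.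
by rewrite -(wU u erefl) -(wU v e).
Qed.

Lemma normal_mono_mono (N : ideal C) K X (k : hom K X) : normal_mono N k -> mono k.
Proof. by move=> [Y [f /kernel_mono]]. Qed.

Lemma cokernel_epi (N : ideal C) X Y Q (f : hom X Y) (q : hom Y Q) :
  is_cokernel N f q -> epi q.
Proof.
move=> [qf0 qU] W u v e.
have [|w [_ wU]] := qU W (u ∘ q); first by rewrite -compA; apply: null_compl.
by rewrite -(wU u erefl) -(wU v e).
Qed.

Lemma kernel_factors (N : ideal C) X Y K W (f : hom X Y) (k : hom K X) (g : hom W X) :
  is_kernel N f k -> null N (f ∘ g) -> factors g k.
Proof. by move=> [_ kU] /kU [u [-> _]]; exists u. Qed.

(** The two zero objects may differ; a morphism [w] between them gives [u' = w ∘ u] by terminality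
    and [v = v' ∘ w] by initiality. *)
Lemma zero_hom_eq X Y (f g : hom X Y) : is_zero_hom f -> is_zero_hom g -> f = g.
Proof.
move=> [Z [[_ iZ] [v [u ->]]]] [Z' [[tZ' iZ'] [v' [u' ->]]]].
have [w _] := tZ' Z.
have [x [_ xU]] := tZ' X; rewrite -(xU u' I) (xU (w ∘ u) I) compA.
by have [y [_ yU]] := iZ Y; rewrite -(yU v I) -(yU (v' ∘ w) I).
Qed.

Hypothesis hC : pointed C.

Lemma zero_hom_ex X Y : exists f : hom X Y, is_zero_hom f.
Proof.
have [Z hZ] := hC; have [/(_ X) [u _] /(_ Y) [v _]] := hZ.
by exists (v ∘ u), Z; split=> //; exists v, u.
Qed.

Lemma epi_zero X Y Z (g : hom Y Z) (f : hom X Y) :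
  epi f -> is_zero_hom (g ∘ f) -> is_zero_hom g.
Proof.
move=> ef gf0; have [z z0] := zero_hom_ex Y Z.
rewrite (ef _ g z) //; apply: zero_hom_eq => //; exact: is_zero_hom_compr.
Qed.

Lemma mono_zero X Y Z (g : hom Y Z) (f : hom X Y) :
  mono g -> is_zero_hom (g ∘ f) -> is_zero_hom f.
Proof.
move=> mg gf0; have [z z0] := zero_hom_ex X Y.
rewrite (mg _ f z) //; apply: zero_hom_eq => //; exact: is_zero_hom_compl.
Qed.

(* The kernel of an identity of the zero object makes zero morphisms null.
   Conversely every null morphism into Y factors through the normal mono part m
   of Z -> Y, whose domain is again a zero object. *)
Lemma exact_zero_ideal (N : ideal C) : exact N -> N = zero_ideal C.
Proof.
move=> [kerN cokN facN].
have null_zero X Y (f : hom X Y) : null N f <-> is_zero_hom f.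
  have zero_null V W (g : hom V W) : is_zero_hom g -> null N g.
    move=> [Z [hZ [v [u ->]]]]; apply: null_compl.
    have [K [k [k0 _]]] := kerN _ _ (idm Z); rewrite comp1m in k0.
    have [z _] := zero_hom_ex V K.
    have [x [_ xU]] := hZ.1 V.
    by rewrite -(xU u I) (xU (k ∘ z) I); apply: null_compr.
  split=> [f0|]; last exact: zero_null.
  have [Z hZ] := hC; have [z _] := hZ.2 Y.
  have [I [m [e [zE eN [Y' [g mK]]]]]] := facN _ _ z.
  have ee : epi e by case: eN => ? [? /cokernel_epi].
  have [c _] := hZ.1 I.
  have ec : e ∘ c = idm I.
    apply: ee; rewrite comp1m -compA.
    by have [x [_ xU]] := hZ.1 Z; rewrite -(xU (c ∘ e) Logic.I) (xU (idm Z) Logic.I) compm1.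
  have [u ->] : factors f m by apply: (kernel_factors mK); apply: null_compl.
  apply: is_zero_hom_compr; exists Z; split=> //; exists z, c.
  by rewrite zE -compA ec compm1.
case: N null_zero {kerN cokN facN} => n nl nr /= nE.
have e : n = @is_zero_hom C.
  apply: functional_extensionality_dep => X; apply: functional_extensionality_dep => Y.
  by apply: functional_extensionality_dep => f; apply/propext; apply: nE.
by subst n; congr Ideal; apply: Prop_irrelevance.
Qed.

Lemma puppe_mitchell_grandis : puppe_mitchell_exact C <-> grandis_exact C.
Proof.
split=> [[_ E]|[N E]]; first by exists (zero_ideal C).
by split=> //; rewrite -(exact_zero_ideal E).
Qed.

End Category.

(** * The order on the clusters of a form *)

Section Forms.
Variables (C : category) (F : form C).
Implicit Types X Y Z : C.

Lemma geq_refl X (S : cluster F X) : S ≤ S.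
Proof. by case: S => A e; destruct e; exists (idm A); rewrite /= fhom_id. Qed.

Lemma geq_trans X Y Z (f : hom X Y) (g : hom Y Z)
    (A : cluster F X) (B : cluster F Y) (D : cluster F Z) :
  D ≥[g] B -> B ≥[f] A -> D ≥[g ∘ f] A.
Proof.
case: A B D => [a ea] [b eb] [d ed]; destruct ea, eb, ed => /= -[h' <-] [h <-].
by exists (h' ∘ h); rewrite /= fhom_comp.
Qed.

Lemma le_trans X (S T U : cluster F X) : S ≤ T -> T ≤ U -> S ≤ U.
Proof. by move=> ST TU; rewrite -(comp1m (idm X)); apply: geq_trans ST. Qed.

Lemma geq_le X Y (f : hom X Y) (S T : cluster F X) (U : cluster F Y) :
  U ≥[f] T -> S ≤ T -> U ≥[f] S.
Proof. by move=> UT ST; rewrite -(compm1 f); apply: geq_trans ST. Qed.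

Lemma le_geq X Y (f : hom X Y) (S : cluster F X) (T U : cluster F Y) :
  T ≤ U -> T ≥[f] S -> U ≥[f] S.
Proof. by move=> TU TS; rewrite -(comp1m f); apply: geq_trans TS. Qed.

(** The two witnessing morphisms are mutually inverse by faithfulness, so amnesticity identifies the
    underlying objects. *)
Lemma le_anti X (S T : cluster F X) : S ≤ T -> T ≤ S -> S = T.
Proof.
case: S T => [a ea] [b eb]; destruct eb => -[/= h hE] [/= h' hE'].
have idh : is_identity (fhom (form_fun F) h) by exists ea.
have isoh : is_iso h.
  by exists h'; split; apply: form_faithful; rewrite fhom_comp fhom_id;
    move: hE hE'; move: (fhom _ h) (fhom _ h'); destruct ea => /= p q -> ->; rewrite comp1m.
have [e _] := form_amnestic isoh idh.
by move: ea {h h' hE hE' idh isoh}; destruct e => ea; rewrite (Prop_irrelevance ea erefl).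
Qed.

End Forms.

(** * Images and kernels in an orean form *)

Section OreanForms.
Variables (C : category) (F : form C) (O : orean F).
Implicit Types X Y Z W : C.

Lemma geq_dimg X Y (f : hom X Y) (S : cluster F X) (T : cluster F Y) :
  dimg O f S ≤ T -> T ≥[f] S.
Proof. by move=> /le_geq; apply; apply: dimg_geq. Qed.

Lemma geq_iimg X Y (f : hom X Y) (S : cluster F X) (T : cluster F Y) :
  S ≤ iimg O f T -> T ≥[f] S.
Proof. by apply: geq_le; apply: iimg_geq. Qed.

(** The forward direction rests on (O2): a cluster interpolated at [Y] lies above [Im O f]. *)
Lemma geq_Im X Y Z (f : hom X Y) (g : hom Y Z) (T : cluster F Z) :
  T ≥[g ∘ f] top O X <-> T ≥[g] Im O f.
Proof.
split=> [TfX|TI]; last by apply: (geq_trans TI); apply: dimg_geq.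
have [B [TB BX]] := geq_interp O TfX.
by apply: geq_le TB _; apply: dimg_least.
Qed.

Lemma le_Ker_Im X Y Z (f : hom X Y) (g : hom Y Z) :
  Im O f ≤ Ker O g <-> bot O Z ≥[g ∘ f] top O X.
Proof. by split=> [/geq_iimg|] /geq_Im //; apply: iimg_largest. Qed.

Lemma Im_comp_le X Y Z (f : hom X Y) (g : hom Y Z) : Im O (g ∘ f) ≤ Im O g.
Proof.
apply/dimg_least/(@geq_trans _ _ _ _ _ _ _ _ (top O Y)); first exact: dimg_geq.
exact/geq_dimg/le_top.
Qed.

Lemma Ker_comp_le X Y Z (f : hom X Y) (g : hom Y Z) : Ker O f ≤ Ker O (g ∘ f).
Proof.
apply/iimg_largest/(@geq_trans _ _ _ _ _ _ _ _ (bot O Y)); last exact: iimg_geq.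
exact/geq_iimg/bot_le.
Qed.

Lemma Ker_id X : Ker O (idm X) = bot O X.
Proof. by apply: le_anti; [apply: iimg_geq | apply: bot_le]. Qed.

Lemma Im_id X : Im O (idm X) = top O X.
Proof. by apply: le_anti; [apply: le_top | apply: dimg_geq]. Qed.

Lemma embedding_mono X (S : cluster F X) W (m : hom W X) : is_embedding O S m -> mono m.
Proof.
move=> [mS mU] V u v e.
have [|w [_ wU]] := mU V (m ∘ u); first by rewrite -mS; apply: Im_comp_le.
by rewrite -(wU u erefl) -(wU v e).
Qed.

Lemma quotient_epi X (S : cluster F X) Y (q : hom X Y) : is_quotient O S q -> epi q.
Proof.
move=> [qS qU] V u v e.
have [|w [_ wU]] := qU V (u ∘ q); first by rewrite -qS; apply: Ker_comp_le.
by rewrite -(wU u erefl) -(wU v e).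
Qed.

Section Pointed.
Hypotheses (hC : pointed C) (hn : normal_form O).

(** With [S] written as [Ker O f], the morphism [r] into the zero object is a retraction of [f], so
    [S] lies below the kernel of an identity. *)
Lemma zero_object_cluster Z (S : cluster F Z) : is_zero_object Z -> S ≤ bot O Z.
Proof.
move=> [hZ _]; have [Y [f <-]] := hn S.
have [r _] := hZ Y.
suff <- : Ker O (r ∘ f) = bot O Z by apply: Ker_comp_le.
rewrite -Ker_id; congr Ker.
by have [x [_ xU]] := hZ Z; rewrite -(xU (r ∘ f) I) (xU (idm Z) I).
Qed.

Lemma zero_geq X Y (f : hom X Y) : is_zero_hom f -> bot O Y ≥[f] top O X.
Proof.
move=> [Z [hZ [v [u ->]]]]; apply: (@geq_trans _ _ _ _ _ _ _ _ (top O Z)).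
- by apply: geq_le (zero_object_cluster _ hZ); apply/geq_iimg/bot_le.
- exact/geq_dimg/le_top.
Qed.

(** Pointedness supplies a zero endomorphism of [X], whose image is least. *)
Lemma bot_conormal X : conormal_cluster O (bot O X).
Proof.
have [f f0] := zero_hom_ex hC X X; exists X, f.
by apply: le_anti; [apply/dimg_least/zero_geq | apply: bot_le].
Qed.

End Pointed.
End OreanForms.

(** * Binormal forms with (N2): exactness of the category and (N1) *)

Section BinormalN2.
Variables (C : category) (F : form C) (O : orean F).
Hypotheses (hC : pointed C) (hn : normal_form O) (hc : conormal_form O) (h2 : N2 O).
Implicit Types X Y Z W : C.

Lemma embedding_ex X (S : cluster F X) : exists (W : C) (m : hom W X), is_embedding O S m.
Proof.
by have [W [f <-]] := hc S; have [I [m [e [_ mE _]]]] := h2 f; exists I, m.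
Qed.

Lemma quotient_ex X (S : cluster F X) : exists (Y : C) (q : hom X Y), is_quotient O S q.
Proof.
by have [Y [f <-]] := hn S; have [I [m [e [_ _ eQ]]]] := h2 f; exists I, e.
Qed.

Lemma embedding_factors X (S : cluster F X) W W' (m : hom W X) (f : hom W' X) :
  is_embedding O S m -> (factors f m <-> Im O f ≤ S).
Proof.
move=> [mS mU]; split=> [[u ->]|/mU [u [-> _]]]; last by exists u.
by rewrite -mS; apply: Im_comp_le.
Qed.

Lemma quotient_factors X (S : cluster F X) Y Y' (q : hom X Y) (f : hom X Y') :
  is_quotient O S q -> ((exists u : hom Y Y', f = u ∘ q) <-> S ≤ Ker O f).
Proof.
move=> [qS qU]; split=> [[u ->]|/qU [u [-> _]]]; last by exists u.
by rewrite -qS; apply: Ker_comp_le.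
Qed.

(* Through a zero object, the embedding of the least cluster of Y has zero domain. *)
Lemma zero_geqE X Y (f : hom X Y) : is_zero_hom f <-> bot O Y ≥[f] top O X.
Proof.
split=> [|f0]; first exact: zero_geq.
have [Z hZ] := hC; have [z _] := hZ.2 Y.
have [I [m [e [zE mE eQ]]]] := h2 z.
have [u ->] : factors f m.
  apply/(embedding_factors _ mE); apply: le_trans (bot_le O _); exact: dimg_least.
have [h hE] : exists h, idm Z = h ∘ e.
  by apply/(quotient_factors _ eQ); apply: le_trans (bot_le O _); apply: zero_object_cluster.
have eh : e ∘ h = idm I.
  by apply: (quotient_epi eQ); rewrite -compA -hE compm1 comp1m.
apply: is_zero_hom_compr; exists Z; split=> //; exists z, h.
by rewrite zE -compA eh compm1.
Qed.

(** This dictionary between vanishing composites and inequalities of clusters is what permits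
    diagram chasing with clusters. *)
Lemma zero_comp X Y Z (f : hom X Y) (g : hom Y Z) :
  is_zero_hom (g ∘ f) <-> Im O f ≤ Ker O g.
Proof. by split=> [/zero_geqE/le_Ker_Im|/le_Ker_Im/zero_geqE]. Qed.

Lemma embedding_kernel X Y (f : hom X Y) K (k : hom K X) :
  is_embedding O (Ker O f) k -> is_kernel (zero_ideal C) f k.
Proof.
move=> [kE kU]; split=> [|W g /zero_comp]; last exact: kU.
apply/zero_comp; rewrite kE; exact: geq_refl.
Qed.

Lemma quotient_cokernel X Y (f : hom X Y) Q (q : hom Y Q) :
  is_quotient O (Im O f) q -> is_cokernel (zero_ideal C) f q.
Proof.
move=> [qE qU]; split=> [|W g /zero_comp]; last exact: qU.
apply/zero_comp; rewrite qE; exact: geq_refl.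
Qed.

Lemma embedding_normal_mono X (S : cluster F X) W (m : hom W X) :
  is_embedding O S m -> normal_mono (zero_ideal C) m.
Proof. by have [Y [f <-]] := hn S; exists Y, f; apply: embedding_kernel. Qed.

Lemma quotient_normal_epi X (S : cluster F X) Y (q : hom X Y) :
  is_quotient O S q -> normal_epi (zero_ideal C) q.
Proof. by have [W [f <-]] := hc S; exists W, f; apply: quotient_cokernel. Qed.

(** The (N2) factorization is the exact one: conormality makes [Ker O f] an image, so [e] is a
    cokernel, and normality makes [Im O f] a kernel in the form, so [m] is a kernel in the
    category. *)
Lemma binormal_exact : exact (zero_ideal C).
Proof.
split=> X Y f.
- by have [K [k kE]] := embedding_ex (Ker O f); exists K, k; apply: embedding_kernel.
- by have [Q [q qE]] := quotient_ex (Im O f); exists Q, q; apply: quotient_cokernel.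
- have [I [m [e [fE mE eQ]]]] := h2 f; exists I, m, e; split=> //.
  + exact: quotient_normal_epi eQ.
  + exact: embedding_normal_mono mE.
Qed.

(** If [Ker O m = Im O d], then [m ∘ d] is zero, hence [d] is, hence [Ker O m] is least. So [e] is
    invertible and [m] agrees with the embedding [m'] up to isomorphism. *)
Lemma mono_embedding X Y (m : hom X Y) : mono m -> is_embedding O (Im O m) m.
Proof.
move=> mm; have [I [m' [e [mE mE' eQ]]]] := h2 m.
have [h hE] : exists h, idm X = h ∘ e.
  apply/(quotient_factors _ eQ); have [W [d dE]] := hc (Ker O m).
  rewrite -dE; apply/zero_comp; rewrite comp1m.
  by apply: (mono_zero hC mm); apply/zero_comp; rewrite dE; apply: geq_refl.
have eh : e ∘ h = idm I by apply: (quotient_epi eQ); rewrite -compA -hE compm1 comp1m.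
split=> // W g /(embedding_factors _ mE') [u ->].
exists (h ∘ u); split; first by rewrite mE !compA -(compA m') eh compm1.
by move=> v /esym; rewrite mE -compA => /(embedding_mono mE') <-; rewrite compA -hE comp1m.
Qed.

(** With [Im O e] written as [Ker O c], the composite [c ∘ e] is zero, so [c] is zero and its kernel
    is greatest. *)
Lemma epi_Im X Y (e : hom X Y) : epi e -> top O Y ≤ Im O e.
Proof.
move=> ee; have [W [c cE]] := hn (Im O e).
rewrite -Im_id -cE; apply/zero_comp; rewrite compm1.
by apply: (epi_zero hC ee); apply/zero_comp; rewrite cE; apply: geq_refl.
Qed.

Lemma epi_quotient X Y (e : hom X Y) : epi e -> is_quotient O (Ker O e) e.
Proof.
move=> ee; have [I [m [e' [eE mE eQ]]]] := h2 e.
have [h hE] : factors (idm Y) m.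
  by apply/(embedding_factors _ mE); rewrite Im_id; apply: epi_Im.
have hm : h ∘ m = idm I by apply: (embedding_mono mE); rewrite compA -hE compm1 comp1m.
split=> // W g /(quotient_factors _ eQ) [u ->].
exists (u ∘ h); split; first by rewrite eE compA -(compA u) hm compm1.
by move=> v; rewrite eE compA => /(quotient_epi eQ) ->; rewrite -compA -hE compm1.
Qed.

(** The chase shows that [c ∘ t] is zero. Since [c ∘ m] factors through [e'], it suffices that
    [e' ∘ n] vanishes; this holds because [m' ∘ e' ∘ n = g ∘ t] is zero and [m'] is mono. *)
Lemma le_dimg_iimg X Y (f : hom X Y) (T : cluster F Y) :
  T ≤ Im O f -> T ≤ dimg O f (iimg O f T).
Proof.
move=> Tf.
have [A [c cE]] := hn (dimg O f (iimg O f T)).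
have [B [g gE]] := hn T.
have [K [k kE]] := hc (Ker O (g ∘ f)).
have [I [m [e [fE mE eQ]]]] := h2 f.
have [W [t tE]] := embedding_ex T.
have [J [m' [e' [gmE mE' eQ']]]] := h2 (g ∘ m).
have [n nE] : factors t m by apply/(embedding_factors _ mE); rewrite tE.1.
have cfk0 : is_zero_hom (c ∘ f ∘ k).
  apply/zero_comp; rewrite kE.
  apply/iimg_largest/(@geq_trans _ _ _ _ _ _ _ _ (dimg O f (iimg O f T))).
    by rewrite -cE; apply: iimg_geq.
  apply: (geq_dimg (O := O)); apply: dimg_least; apply: geq_le (dimg_geq O _ _) _.
  apply: iimg_largest; rewrite -gE.
  (* By (O2) the relation passes through some [S] in [Y], and [S ≤ Ker O g]. *)
  have [S [S0 Sf]] := geq_interp O (iimg_geq O (g ∘ f) (bot O B)).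
  by apply: le_geq Sf; apply: iimg_largest.
(* The epi [e' ∘ e] is a quotient of its kernel, which lies below [Ker O (g ∘ f)] and so below
   [Ker O (c ∘ f)]. *)
have [v vE] : exists v, c ∘ f = v ∘ (e' ∘ e).
  apply/(quotient_factors _ (epi_quotient (epi_comp (quotient_epi eQ') (quotient_epi eQ)))).
  apply: (@le_trans _ _ _ _ (Ker O (g ∘ f))); last by rewrite -kE; apply/zero_comp.
  by rewrite fE compA gmE -compA; apply: Ker_comp_le.
have cm : c ∘ m = v ∘ e' by apply: (quotient_epi eQ); rewrite -!compA -fE.
rewrite -cE -tE.1; apply/zero_comp; rewrite nE compA cm -compA.
apply: is_zero_hom_compl; apply: (mono_zero hC (embedding_mono mE')).
by rewrite compA -gmE -compA -nE; apply/zero_comp; rewrite gE tE.1; apply: geq_refl.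
Qed.

(** The dual chase shows that [q ∘ d] is zero: [e ∘ d] factors through [m'], and [q1 ∘ m'] vanishes
    because [q1 ∘ m' ∘ e' = q ∘ u] is zero and [e'] is epi. *)
Lemma iimg_dimg_le X Y (f : hom X Y) (U : cluster F X) :
  Ker O f ≤ U -> iimg O f (dimg O f U) ≤ U.
Proof.
move=> fU.
have [A [d dE]] := hc (iimg O f (dimg O f U)).
have [B [u uE]] := hc U.
have [I [m [e [fE mE eQ]]]] := h2 f.
have [Q [q qQ]] := quotient_ex U.
have [J [m' [e' [euE mE' eQ']]]] := h2 (e ∘ u).
have [q1 q1E] : exists q1, q = q1 ∘ e by apply/(quotient_factors _ eQ); rewrite qQ.1.
(* The mono [m ∘ m'] is an embedding of its image, which lies above [Im O (f ∘ u)], itself a bound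
   for [Im O (f ∘ d)]. *)
have [w wE] : factors (f ∘ d) (m ∘ m').
  apply/(embedding_factors _ (mono_embedding (mono_comp (embedding_mono mE)
    (embedding_mono mE')))).
  apply: (@le_trans _ _ _ _ (Im O (f ∘ u))); last first.
    by rewrite fE -compA euE compA; apply: Im_comp_le.
  apply/dimg_least/geq_Im; rewrite dE.
  apply: le_geq (iimg_geq O _ _); apply: dimg_least.
  by rewrite -uE; apply/geq_Im; apply: dimg_geq.
have ed : e ∘ d = m' ∘ w by apply: (embedding_mono mE); rewrite !compA -fE.
rewrite -dE -qQ.1; apply/zero_comp; rewrite q1E -compA ed compA.
apply: is_zero_hom_compr; apply: (epi_zero hC (quotient_epi eQ')).
by rewrite -compA -euE compA -q1E; apply/zero_comp; rewrite qQ.1 uE; apply: geq_refl.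
Qed.

(** (N3) is immediate from binormality. In each equation of (N1) one inequality is formal; the other
    is one of the two chases, applied to the join with [Ker O f] or the meet with [Im O f]. *)
Lemma binormal_noetherian : noetherian O.
Proof.
split=> //.
have joinP X (S T : cluster F X) : S ≤ join O S T /\ T ≤ join O S T.
  by apply/join_le/geq_refl.
have meetP X (S T : cluster F X) : meet O S T ≤ S /\ meet O S T ≤ T.
  by apply/le_meet/geq_refl.
move=> X Y f; split=> [S|T]; apply: le_anti.
- apply: le_trans (iimg_dimg_le (joinP _ S (Ker O f)).2).
  apply: iimg_largest; apply: le_geq (iimg_geq O _ _).
  by apply: dimg_least; apply: geq_le (dimg_geq O _ _) (joinP _ _ _).1.
- apply/join_le; split; apply: iimg_largest; first exact: dimg_geq.
  by apply: le_geq (iimg_geq O _ _); apply: bot_le.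
- apply/le_meet; split; apply: dimg_least; first exact: iimg_geq.
  by apply: geq_le (dimg_geq O _ _) _; apply: le_top.
- apply: le_trans (le_dimg_iimg (meetP _ T (Im O f)).2) _.
  apply: dimg_least; apply: geq_le (dimg_geq O _ _) _.
  by apply: iimg_largest; apply: le_geq (iimg_geq O _ _); apply: (meetP _ _ _).1.
Qed.

End BinormalN2.

(** * Isomorphisms of forms and transport of orean structures *)

Section Operators.
Variables (C : category) (F G : form C).
Implicit Types X Y Z : C.

(** Reflecting the relations makes [t] injective by antisymmetry, so a choice of preimages is an
    inverse operator. *)
Lemma form_iso_surj (t : operator F G) :
  (forall X Y (f : hom X Y) (B : cluster F Y) (A : cluster F X),
     t Y B ≥[f] t X A -> B ≥[f] A) ->
  (forall X (T : cluster G X), exists S, t X S = T) ->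
  form_iso F G.
Proof.
move=> tR tS; pose s X (T : cluster G X) := sval (cid (tS X T)).
have sK X (T : cluster G X) : t X (s X T) = T by apply: (svalP (cid (tS X T))).
have s_geq X Y (f : hom X Y) (B : cluster G Y) (A : cluster G X) :
  B ≥[f] A -> s Y B ≥[f] s X A by move=> BA; apply: tR; rewrite !sK.
exists t, (Operator s_geq); split=> //= X S.
by apply: le_anti; apply: tR; rewrite sK; apply: geq_refl.
Qed.

Variables (t : operator F G) (s : operator G F) (O : orean F).
Hypothesis tK : forall X (S : cluster F X), s X (t X S) = S.
Hypothesis sK : forall X (S : cluster G X), t X (s X S) = S.

Lemma iso_op_geq X Y (f : hom X Y) (B : cluster F Y) (A : cluster F X) :
  t Y B ≥[f] t X A -> B ≥[f] A.
Proof. by move=> /(op_geq s); rewrite !tK. Qed.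

(** Kept transparent so that images and kernels of the transported structure compute. *)
Definition iso_orean : orean G.
Proof.
refine (@Orean C G (fun X => t X (bot O X)) (fun X => t X (top O X))
  (fun X S T => t X (join O (s X S) (s X T))) (fun X S T => t X (meet O (s X S) (s X T)))
  _ _ _ _ _
  (fun X Y f S => t Y (dimg O f (s X S))) (fun X Y f T => t X (iimg O f (s Y T)))
  _ _ _ _).
- by move=> X S; rewrite -(sK S); apply/op_geq/bot_le.
- by move=> X S; rewrite -(sK S); apply/op_geq/le_top.
- move=> X S T U; rewrite -(sK U) -{2}(sK S) -{2}(sK T).
  split=> [/iso_op_geq/join_le [SU TU]|[/iso_op_geq SU /iso_op_geq TU]].
  + by split; apply: op_geq.
  + by apply/op_geq/join_le.
- move=> X S T U; rewrite -(sK U) -{2}(sK S) -{2}(sK T).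
  split=> [/iso_op_geq/le_meet [SU TU]|[/iso_op_geq SU /iso_op_geq TU]].
  + by split; apply: op_geq.
  + by apply/op_geq/le_meet.
- move=> X Y Z f g A D /(op_geq s) /(geq_interp O) [B [DB BA]].
  by exists (t Y B); split; [rewrite -(sK D) | rewrite -(sK A)]; apply: op_geq.
- by move=> X Y f S; rewrite -{2}(sK S); apply/op_geq/dimg_geq.
- by move=> X Y f S T /(op_geq s) TS; rewrite -(sK T); apply/op_geq/dimg_least.
- by move=> X Y f T; rewrite -{1}(sK T); apply/op_geq/iimg_geq.
- by move=> X Y f S T /(op_geq s) TS; rewrite -(sK S); apply/op_geq/iimg_largest.
Defined.

Lemma iso_Im X Y (f : hom X Y) : Im iso_orean f = t Y (Im O f).
Proof. by rewrite /Im /= tK. Qed.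

Lemma iso_Ker X Y (f : hom X Y) : Ker iso_orean f = t X (Ker O f).
Proof. by rewrite /Ker /= tK. Qed.

End Operators.

(** * Exact meet decompositions, normality and conormality *)

Section Decompositions.
Variables (C : category) (F : form C) (O : orean F).
Implicit Types X Y : C.

Definition id_op : operator F F :=
  Operator (fun (X Y : C) (f : hom X Y) (B : cluster F Y) (A : cluster F X) BA => BA).

Lemma id_op_idem : idempotent_op id_op.
Proof. by []. Qed.

Lemma fixed_restrK (t : operator F F) (idt : idempotent_op t) X (S : cluster F X) :
  fixed_incl t X (fixed_restr idt X S) = t X S.
Proof. by rewrite /= /subform_incl_map /=; case: (t X S). Qed.

Lemma fixed_inclK (t : operator F F) (idt : idempotent_op t) X
    (S : cluster (fixed_form t) X) :
  fixed_restr idt X (fixed_incl t X S) = S.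
Proof.
have e : t X (fixed_incl t X S) = fixed_incl t X S.
  by case: S => -[A q] e; destruct e.
(* The order of a subform is by definition that of [F], so antisymmetry can be checked after
   inclusion. *)
by apply: le_anti; change (?x ≤ ?y) with (fixed_incl t X x ≤ fixed_incl t X y);
  rewrite fixed_restrK e; apply: geq_refl.
Qed.

(** Both idempotents are taken to be the identity. The resulting fixed form is an isomorphic copy of
    [F], hence the transported structure [O']. *)
Lemma binormal_right_exact : binormal_form O -> has_right_exact_meet_decomposition O.
Proof.
move=> [hn hc].
have rK X (S : cluster F X) : fixed_incl id_op X (fixed_restr id_op_idem X S) = S.
  exact: fixed_restrK.
pose O' : orean (fixed_form id_op) := iso_orean O rK (fixed_inclK id_op_idem).
have ImE X Y (f : hom X Y) : Im O' f = fixed_restr id_op_idem Y (Im O f) by apply: iso_Im.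
have KerE X Y (f : hom X Y) : Ker O' f = fixed_restr id_op_idem X (Ker O f) by apply: iso_Ker.
have O'c : conormal_form O'.
  move=> X S; have [W [f fE]] := hc X (fixed_incl id_op X S).
  by exists W, f; rewrite ImE fE fixed_inclK.
have O'n : normal_form O'.
  move=> X S; have [W [f fE]] := hn X (fixed_incl id_op X S).
  by exists W, f; rewrite KerE fE fixed_inclK.
have meetE X (S : cluster F X) : S = meet O S S.
  by apply: le_anti; [apply/le_meet; split; apply: geq_refl|have /le_meet[] := geq_refl (meet O S S)].
exists (MeetDecomposition id_op_idem id_op_idem O'c O'n meetE); split=> //.
split=> /=.
- by split; split=> X Y f; rewrite ?ImE ?KerE.
- by exists (Operator (fun _ _ _ _ _ BA => BA)).
- by exists (Operator (fun _ _ _ _ _ BA => BA)).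
- by move=> X Y f; rewrite ImE rK.
- by move=> X Y f; rewrite KerE rK.
Qed.

(** Every [S] is fixed by [kappa_e], hence is a kernel in the normal form of fixed clusters, and the
    inclusion preserves kernels. *)
Lemma right_exact_normal : has_right_exact_meet_decomposition O -> normal_form O.
Proof.
move=> [D [right [_ _ _ _ inclN]]] X S.
have [Y [f fE]] := orean_e_normal (fixed_restr (kappa_e_idem D) X S).
exists Y, f; rewrite (right X S) -(fixed_restrK (kappa_e_idem D)) -fE.
by symmetry; apply: inclN.
Qed.

(* Im 0 = bot makes kappa_s fix bot, so the normality of F -> F_s gives
   kappa_s (Ker f) <= Ker f, while S <= kappa_s S holds in any meet decomposition. *)
Lemma exact_normal_conormal :
  pointed C -> normal_form O -> has_exact_meet_decomposition O -> conormal_form O.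
Proof.
move=> hC hn [D [[[sN sC] _] _ _ inclC _]] X S.
pose i := fixed_incl (kappa_s D); pose r := fixed_restr (kappa_s_idem D).
have ri Y (T : cluster F Y) : i Y (r Y T) = kappa_s D Y T by apply: fixed_restrK.
have sIm Y Z (f : hom Y Z) : kappa_s D Z (Im O f) = Im O f.
  by rewrite -ri /r sC; apply: inclC.
have sS : S ≤ kappa_s D X S.
  by have /le_meet [] : S ≤ meet O (kappa_s D X S) (kappa_e D X S);
    first by rewrite -meet_kappa; apply: geq_refl.
suff <- : kappa_s D X S = S.
  have [W [f fE]] := orean_s_conormal (r X S).
  by exists W, f; rewrite -ri -fE; symmetry; apply: inclC.
apply: le_anti sS; have [Y [f <-]] := hn X S.
apply: iimg_largest; rewrite -ri /r sN.
have bot_s : i Y (bot (orean_s D) Y) ≤ bot O Y.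
  have [W [g gE]] := bot_conormal hC hn Y.
  have := op_geq i (bot_le (orean_s D) (r Y (bot O Y))).
  by rewrite ri -gE sIm.
by apply: le_geq bot_s _; apply: (op_geq i); apply: iimg_geq.
Qed.

End Decompositions.

(** * Clusters of normal subobjects and their representatives *)

Section NormalSubobjects.
Variables (C : category) (N : ideal C).
Implicit Types X Y W : C.

(** A cluster in [X] carries its own object and a proof that it equals [X]; the class is transported
    along that proof. *)
Definition class_of X (S : cluster (normal_subobjects N) X) : nsub N X :=
  match proj2_sig S in _ = X' return nsub N X' with
  | erefl => projT2 (sval S)
  end.

Definition of_class X (P : nsub N X) : cluster (normal_subobjects N) X :=
  exist _ (existT (nsub N) X P) erefl.

Lemma class_ofK X (S : cluster (normal_subobjects N) X) : of_class (class_of S) = S.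
Proof. by case: S => -[Y P] /= e; destruct e. Qed.

Lemma geq_nsub X Y (f : hom X Y) (T : cluster (normal_subobjects N) Y)
    (S : cluster (normal_subobjects N) X) :
  T ≥[f] S <-> nsub_geq f (class_of T) (class_of S).
Proof.
case: S T => -[X' P] /= e [[Y' Q] /= e']; destruct e, e'.
by split=> [[[h hE] <-]//|fPQ]; exists (exist _ f fPQ).
Qed.

Lemma nsub_self X W (s : hom W X) : normal_mono N s ->
  is_nsub_class N (fun W' t => normal_mono N t /\ @mutually_factor C X W W' s t).
Proof. by move=> sN; exists W, s. Qed.

Lemma mutually_factor_refl X W (s : hom W X) : mutually_factor s s.
Proof. by split; exists (idm W); rewrite compm1. Qed.

Lemma nsub_ex X (P : nsub N X) : exists W (s : hom W X), sval P W s.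
Proof.
case: P => P /= [W [s [sN sP]]]; exists W, s; apply/sP; split=> //.
exact: mutually_factor_refl.
Qed.

Lemma nsub_normal_mono X (P : nsub N X) W (s : hom W X) : sval P W s -> normal_mono N s.
Proof. by case: P => P /= [V [t [_ tP]]] /tP []. Qed.

(** Members of one class factor through each other, so any representatives may be used to test the
    relation. *)
Lemma nsub_geqP X Y (f : hom X Y) (T : nsub N Y) (S : nsub N X) V W
    (t : hom V Y) (s : hom W X) :
  sval T V t -> sval S W s -> (nsub_geq f T S <-> factors (f ∘ s) t).
Proof.
move=> Tt Ss; split=> [[V' [W' [t' [s' [Tt' Ss' [u fs']]]]]]|[u fs]]; last first.
  by exists V, W, t, s; split=> //; exists u.
have [v sE] := nsub_mem Ss Ss'; have [v' tE] := nsub_mem Tt' Tt.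
by exists (v' ∘ u ∘ v); rewrite sE compA fs' tE !compA.
Qed.

End NormalSubobjects.

(** * A binormal form with (N2) is the form of normal subobjects *)

Section BinormalIso.
Variables (C : category) (F : form C) (O : orean F).
Hypotheses (hC : pointed C) (hn : normal_form O) (hc : conormal_form O) (h2 : N2 O).
Implicit Types X Y W : C.

(** Two embeddings of [S] factor through each other; conversely, mutual factorization preserves
    images, and a mono is an embedding of its image. *)
Lemma embeddings_nsub X (S : cluster F X) :
  is_nsub_class (zero_ideal C) (fun W (m : hom W X) => is_embedding O S m).
Proof.
have [W [s sE]] := embedding_ex hc h2 S.
exists W, s; split; first exact: embedding_normal_mono sE.
move=> W' t; split=> [tE|[/normal_mono_mono mt [st ts]]].
  split; first exact: embedding_normal_mono tE.
  split; [apply/(embedding_factors _ tE) | apply/(embedding_factors _ sE)].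
  - by rewrite sE.1; apply: geq_refl.
  - by rewrite tE.1; apply: geq_refl.
have tS : Im O t = S.
  apply: le_anti; first exact/(embedding_factors _ sE).
  by rewrite -sE.1; case: st => u ->; apply: Im_comp_le.
by rewrite -tS; apply: mono_embedding.
Qed.

Definition embeddings X (S : cluster F X) : nsub (zero_ideal C) X :=
  exist _ _ (embeddings_nsub S).

Lemma geq_embeddings X Y (f : hom X Y) (T : cluster F Y) (S : cluster F X) :
  T ≥[f] S <-> nsub_geq f (embeddings T) (embeddings S).
Proof.
have [W [s sE]] := embedding_ex hc h2 S; have [V [t tE]] := embedding_ex hc h2 T.
apply: iff_trans (iff_sym (nsub_geqP _ _ _)); [|exact: tE|exact: sE].
apply: iff_trans (iff_sym (embedding_factors _ tE)).
rewrite -sE.1; split=> [TS|fsT]; first exact/dimg_least/geq_Im.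
by apply/geq_Im; apply: geq_dimg fsT.
Qed.

Lemma binormal_form_iso : form_iso F (normal_subobjects (zero_ideal C)).
Proof.
pose t X (S : cluster F X) := of_class (embeddings S).
have tE X Y (f : hom X Y) (T : cluster F Y) (S : cluster F X) :
    T ≥[f] S <-> t Y T ≥[f] t X S.
  exact: iff_trans (geq_embeddings f T S) (iff_sym (geq_nsub f (t Y T) (t X S))).
have tG X Y (f : hom X Y) (T : cluster F Y) (S : cluster F X) :
  T ≥[f] S -> t Y T ≥[f] t X S by move/tE.
apply: (form_iso_surj (t := Operator tG)) => [X Y f T S /tE //|X P].
have [W [s sP]] := nsub_ex (class_of P).
have ms := normal_mono_mono (nsub_normal_mono sP).
(* The mono [s] lies both in the given class and in that of the embeddings of its image, so the two
   classes coincide. *)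
have sE : sval (embeddings (Im O s)) W s := mono_embedding hC hn hc h2 ms.
have ss : factors (idm X ∘ s) s by exists (idm W); rewrite comp1m compm1.
exists (Im O s); rewrite -(class_ofK P) /= /t; congr of_class.
by apply: nsub_geq_anti; [apply/(nsub_geqP _ sE sP) | apply/(nsub_geqP _ sP sE)].
Qed.

End BinormalIso.

(** * In an exact category the form of normal subobjects is binormal with (N2) *)

Section ExactBinormal.
Variables (C : category) (F : form C) (O : orean F).
Hypotheses (hC : pointed C) (hE : exact (zero_ideal C)).
Variables (t : operator F (normal_subobjects (zero_ideal C)))
  (s : operator (normal_subobjects (zero_ideal C)) F).
Hypothesis tK : forall X (S : cluster F X), s X (t X S) = S.
Hypothesis sK : forall X (S : cluster (normal_subobjects (zero_ideal C)) X), t X (s X S) = S.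
Implicit Types X Y V W : C.

(** This carries the isomorphism: a cluster of [F] is handled through any normal mono of the class
    matched with it. *)
Definition represents X W (m : hom W X) (S : cluster F X) : Prop :=
  sval (class_of (t X S)) W m.

Lemma represents_ex X (S : cluster F X) : exists W (m : hom W X), represents m S.
Proof. exact: nsub_ex. Qed.

Lemma represents_normal_mono X W (m : hom W X) (S : cluster F X) :
  represents m S -> normal_mono (zero_ideal C) m.
Proof. exact: nsub_normal_mono. Qed.

Lemma represents_geq X Y (f : hom X Y) V W (b : hom V Y) (a : hom W X)
    (T : cluster F Y) (S : cluster F X) :
  represents b T -> represents a S -> (T ≥[f] S <-> factors (f ∘ a) b).
Proof.
move=> bT aS; apply: iff_trans (nsub_geqP f bT aS).
by apply: iff_trans (geq_nsub f _ _); split; [apply: op_geq | apply: (iso_op_geq tK)].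
Qed.

Lemma normal_mono_represents X W (m : hom W X) :
  normal_mono (zero_ideal C) m -> exists S, represents m S.
Proof.
move=> mN; exists (s X (of_class (exist _ _ (nsub_self mN)))).
by rewrite /represents sK; split=> //; apply: mutually_factor_refl.
Qed.

Lemma kernel_represents X Y K (f : hom X Y) (k : hom K X) :
  is_kernel (zero_ideal C) f k -> exists S, represents k S.
Proof. by move=> kK; apply: normal_mono_represents; exists Y, f. Qed.

Lemma represents_inj X W (m : hom W X) (S T : cluster F X) :
  represents m S -> represents m T -> S = T.
Proof.
have mm : factors (idm X ∘ m) m by exists (idm W); rewrite comp1m compm1.
by move=> mS mT; apply: le_anti; [apply/(represents_geq _ mT mS) | apply/(represents_geq _ mS mT)].
Qed.

(** An identity is a kernel of a zero endomorphism, and everything factors through it. *)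
Lemma represents_top X : represents (idm X) (top O X).
Proof.
have [z z0] := zero_hom_ex hC X X.
have [|T TE] := @kernel_represents X X X z (idm X).
  split=> [|W g _]; first exact: is_zero_hom_compr.
  by exists g; split=> [|u]; rewrite comp1m.
suff -> : top O X = T by [].
apply: le_anti; last exact: le_top.
have [W [m mE]] := represents_ex (top O X).
by apply/(represents_geq _ TE mE); exists m; rewrite !comp1m.
Qed.

(** The representative factors through a kernel of the identity, which is zero. *)
Lemma represents_bot X W (b : hom W X) : represents b (bot O X) -> is_zero_hom b.
Proof.
move=> bE; have [kerE _ _] := hE; have [K [k kK]] := kerE _ _ (idm X).
have [S SE] := kernel_represents kK.
have /(represents_geq _ SE bE) [u] := bot_le O S.
rewrite comp1m => ->; apply: is_zero_hom_compr.
by have [+ _] := kK; rewrite /= comp1m.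
Qed.

Lemma represents_Ker X Y K (f : hom X Y) (k : hom K X) :
  is_kernel (zero_ideal C) f k -> represents k (Ker O f).
Proof.
move=> kK; have [S SE] := kernel_represents kK.
suff -> : Ker O f = S by [].
have [L [l lE]] := represents_ex (Ker O f); have [B [b bE]] := represents_ex (bot O Y).
have b0 := represents_bot bE.
apply: le_anti.
  apply/(represents_geq _ SE lE); rewrite comp1m; apply: (kernel_factors kK).
  have /(represents_geq _ bE lE) [u ->] := iimg_geq O f (bot O Y).
  exact: is_zero_hom_compr.
apply/iimg_largest/(represents_geq _ bE SE).
have [z z0] := zero_hom_ex hC K B; exists z.
by apply: zero_hom_eq; [exact: kK.1 | exact: is_zero_hom_compr].
Qed.

(** For minimality, let [m ∘ e] factor through a kernel [n] of [g]. Then [g ∘ m ∘ e] is zero, so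
    [g ∘ m] is, and [m] factors through [n]. *)
Lemma represents_Im X I Y (m : hom I Y) (e : hom X I) :
  normal_mono (zero_ideal C) m -> epi e -> represents m (Im O (m ∘ e)).
Proof.
move=> mN ee; have [S SE] := normal_mono_represents mN.
suff -> : Im O (m ∘ e) = S by [].
have [J [n nE]] := represents_ex (Im O (m ∘ e)).
apply: le_anti.
  by apply/dimg_least/(represents_geq _ SE (represents_top X)); exists e; rewrite compm1.
apply/(represents_geq _ nE SE); rewrite comp1m.
have [V [g gK]] := represents_normal_mono nE.
apply: (kernel_factors gK); apply: (epi_zero hC ee); rewrite -compA.
have /(represents_geq _ nE (represents_top X)) [u] := dimg_geq O (m ∘ e) (top O X).
by rewrite compm1 => ->; rewrite compA; apply: is_zero_hom_compr; apply: gK.1.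
Qed.

Lemma represents_Im_normal_mono X W (m : hom W X) :
  normal_mono (zero_ideal C) m -> represents m (Im O m).
Proof. by move=> mN; rewrite -{2}(compm1 m); apply: represents_Im; last exact: epi_id. Qed.

Lemma represented_binormal : binormal_form O.
Proof.
split=> X S; have [W [m mS]] := represents_ex S; have mN := represents_normal_mono mS.
  have [Y [f mK]] := mN; exists Y, f; exact: represents_inj (represents_Ker mK) mS.
exists W, m; exact: represents_inj (represents_Im_normal_mono mN) mS.
Qed.

Lemma represented_N2 : N2 O.
Proof.
have [kerE _ facE] := hE.
have epiN X Y (e : hom X Y) : normal_epi (zero_ideal C) e -> epi e.
  by move=> [? [? /cokernel_epi]].
move=> X Y f; have [I [m [e [fE eN mN]]]] := facE _ _ f.
have mm := normal_mono_mono mN.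
have mIm : represents m (Im O f) by rewrite fE; apply: represents_Im => //; apply: epiN.
have [K [k kK]] := kerE _ _ f.
(* Since [m] is mono, [f] and [e] have the same kernels. *)
have kKe : is_kernel (zero_ideal C) e k.
  have [fk0 kU] := kK; split=> [|W g eg0]; last first.
    by apply: kU; rewrite fE -compA; apply: is_zero_hom_compl.
  by apply: (mono_zero hC mm); rewrite /= compA -fE.
exists I, m, e; split=> //; split.
- exact: represents_inj (represents_Im_normal_mono mN) mIm.
- move=> W g; have [J [n [d [gE dN nN]]]] := facE _ _ g.
  have nIm : represents n (Im O g) by rewrite gE; apply: represents_Im => //; apply: epiN.
  move=> /(represents_geq _ mIm nIm) [u]; rewrite comp1m => nu.
  exists (u ∘ d); split; first by rewrite gE nu compA.
  by move=> v; rewrite gE nu -compA => /mm.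
- exact: represents_inj (represents_Ker kKe) (represents_Ker kK).
- move=> W g le; have [V [c eC]] := eN.
  (* [e] is a cokernel of [c], which factors through [k]; so [g ∘ k] being zero yields the
     factorization of [g] through [e]. *)
  have gk0 : is_zero_hom (g ∘ k).
    have [B [b bE]] := represents_ex (bot O W).
    have /(represents_geq _ bE (represents_Ker kK)) [u ->] := geq_iimg le.
    by apply: is_zero_hom_compr; apply: represents_bot bE.
  have [u cE] := kernel_factors kKe eC.1.
  by apply: eC.2; rewrite cE compA; apply: is_zero_hom_compr.
Qed.

End ExactBinormal.

Unset Implicit Arguments.

Theorem theorem156 (C : category) (hC : pointed C) (F : form C) (O : orean F) :
  (puppe_mitchell_exact C <-> grandis_exact C) /\
  [<-> puppe_mitchell_exact C /\ form_iso F (normal_subobjects (zero_ideal C));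
       exists N : ideal C, exact N /\ form_iso F (normal_subobjects N);
       binormal_form O /\ noetherian O;
       normal_form O /\ noetherian O /\ has_exact_meet_decomposition O;
       noetherian O /\ has_right_exact_meet_decomposition O;
       N2 O /\ has_right_exact_meet_decomposition O;
       normal_form O /\ N2 O /\ has_exact_meet_decomposition O;
       binormal_form O /\ N2 O].
Proof.
split; first exact: puppe_mitchell_grandis.
have right_exact : has_right_exact_meet_decomposition O -> has_exact_meet_decomposition O.
  by move=> [D [_ DE]]; exists D.
tfae.
- by move=> [[_ E] iso]; exists (zero_ideal C).
- move=> [N [E iso]]; have NE := exact_zero_ideal hC E; subst N.
  have [t [s [tK sK]]] := iso.
  have [hn hc] := represented_binormal O hC E tK sK.
  by split=> //; apply: binormal_noetherian => //; apply: represented_N2 tK sK.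
- move=> [bn noeth]; split; first by case: bn.
  by split=> //; apply/right_exact/binormal_right_exact.
(* The given decomposition yields conormality; the right one is then built anew from identities. *)
- move=> [hn [noeth dec]]; split=> //; apply: binormal_right_exact.
  by split=> //; apply: exact_normal_conormal.
- by move=> [[_ n2 _] dec].
- by move=> [n2 dec]; split; [apply: right_exact_normal | split; last exact: right_exact].
- by move=> [hn [n2 dec]]; split=> //; split=> //; apply: exact_normal_conormal.
- move=> [[hn hc] n2]; split; last exact: binormal_form_iso.
  by split=> //; apply: (binormal_exact (O := O)).
Qed.
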